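(* Let $G$ be a graph obtained by edge-pasting together finite partial cubes $G_1$ and $G_2$. Then $$\dim_I(G)=\dim_I(G_1)+\dim_I(G_2)-1.$$
   Context: Graphs are simple, undirected and nonempty. For a set $X$, the hypercube $\mathcal H(X)$ is the graph whose vertices are the finite subsets of $X$, with $P,Q$ adjacent iff $|P\Delta Q|=1$; its dimension is the cardinality $|X|$. A graph is a partial cube if it can be isometrically embedded (i.e. by a map preserving shortest-path distances) into some $\mathcal H(X)$. The isometric dimension $\dim_I(G)$ of a partial cube $G$ is the minimum possible dimension of a hypercube $\mathcal H(X)$ into which $G$ is isometrically embeddable. Edge-pasting: given connected graphs $G_1=(V_1,E_1)$, $G_2=(V_2,E_2)$ and edges $a_1b_1\in E_1$, $a_2b_2\in E_2$, the graph obtained by edge-pasting is the graph obtained from the disjoint union of $G_1$ and $G_2$ by identifying $a_1$ with $a_2$, $b_1$ with $b_2$, and the edge $a_1b_1$ with the edge $a_2b_2$ (and making no other identifications). A graph obtained by edge-pasting from partial cubes is a partial cube. *)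

(* Defs.v *)
From HB Require Import structures.
From mathcomp Require Import all_boot.
From mathcomp Require Import finmap.
From mathcomp Require Import boolp classical_sets functions cardinality.

Set Implicit Arguments.
Unset Strict Implicit.
Unset Printing Implicit Defensive.

Local Open Scope classical_set_scope.
Local Open Scope card_scope.
Local Open Scope nat_scope.

(* Vertex sets may be infinite, since the hypercube on X has one vertex per
   finite subset of X. Taking a choiceType with a boolean adjacency relation is
   classically no restriction. *)
Record sgraph := SGraph {
  vertex :> choiceType;
  adj : rel vertex;
  adj_sym : symmetric adj;
  adj_irr : irreflexive adj;
  vertex_inhabited : inhabited vertex
}.

Definition has_walk (G : sgraph) (x y : G) (n : nat) : Prop :=
  exists2 s : seq G, path (@adj G) x s & last x s = y /\ size s = n.

(* Shortest-path distance; None stands for infinite distance. *)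
Definition dist (G : sgraph) (x y : G) : option nat :=
  match pselect (exists n, `[< has_walk x y n >]) with
  | left walks => Some (ex_minn walks)
  | right _ => None
  end.

Definition connected_graph (G : sgraph) : Prop :=
  forall x y : G, exists n, has_walk x y n.

Definition finite_graph (G : sgraph) : Prop := finite_set [set: G].

Definition symdiff (X : choiceType) (P Q : {fset X}) : {fset X} :=
  ((P `\` Q) `|` (Q `\` P))%fset.

Definition hypercube_adj (X : choiceType) : rel {fset X} :=
  fun P Q => #|` symdiff P Q| == 1.

Lemma hypercube_adj_sym (X : choiceType) : symmetric (@hypercube_adj X).
Proof. by move=> P Q; rewrite /hypercube_adj /symdiff fsetUC. Qed.

Lemma hypercube_adj_irr (X : choiceType) : irreflexive (@hypercube_adj X).
Proof.
by move=> P; rewrite /hypercube_adj /symdiff fsetDv fsetUid cardfs0.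
Qed.

Definition hypercube (X : choiceType) : sgraph :=
  SGraph (@hypercube_adj_sym X) (@hypercube_adj_irr X) (inhabits fset0).

Definition isometric_embedding (G H : sgraph) (f : G -> H) : Prop :=
  forall x y : G, dist (f x) (f y) = dist x y.

Definition isometrically_embeddable (G H : sgraph) : Prop :=
  exists f : G -> H, isometric_embedding f.

Definition partial_cube (G : sgraph) : Prop :=
  exists X : choiceType, isometrically_embeddable G (hypercube X).

(* The minimum ranges over hypercubes of arbitrary, possibly infinite,
   dimension. *)
Definition is_isometric_dim (G : sgraph) (n : nat) : Prop :=
  (exists X : choiceType,
     [set: X] #= `I_n /\ isometrically_embeddable G (hypercube X)) /\
  (forall Y : choiceType,
     isometrically_embeddable G (hypercube Y) -> `I_n #<= [set: Y]).

(* The minimum is a natural number for every finite partial cube; the default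
   value 0 is only used when no finite-dimensional hypercube will do. *)
Definition isometric_dim (G : sgraph) : nat :=
  xget 0 [set n | is_isometric_dim G n].

Section EdgePasting.
Variables G1 G2 : sgraph.

Definition disjoint_union_adj (u v : G1 + G2) : bool :=
  match u, v with
  | inl x, inl y => adj x y
  | inr x, inr y => adj x y
  | _, _ => false
  end.

(* The equivalence relation identifying a1 with a2 and b1 with b2, and nothing
   else. *)
Definition pasted (a1 b1 : G1) (a2 b2 : G2) (u v : G1 + G2) : Prop :=
  match u, v with
  | inl x, inl y => x = y
  | inr x, inr y => x = y
  | inl x, inr y | inr y, inl x => (x = a1 /\ y = a2) \/ (x = b1 /\ y = b2)
  end.

(* G is, up to isomorphism, the quotient of the disjoint union of G1 and G2 by
   the above relation, with quotient map q. *)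
Definition edge_pasting (G : sgraph) : Prop :=
  exists (a1 b1 : G1) (a2 b2 : G2) (q : G1 + G2 -> G),
    [/\ connected_graph G1, connected_graph G2, adj a1 b1 & adj a2 b2] /\
    [/\ forall w : G, exists u, q u = w,
        forall u v, q u = q v <-> pasted a1 b1 a2 b2 u v
      & forall w z : G, adj w z <->
          exists u v, [/\ q u = w, q v = z & disjoint_union_adj u v]].

End EdgePasting.

(* Main.v *)
(** In a hypercube the distance of P and Q is the size of their symmetric
    difference, so a geodesic from P to Q may pass through W exactly when
    P :&: Q <= W <= P :|: Q.  Translate cube embeddings of the two sides so
    that a is labelled by the empty set and b by a singleton {c}, and let the
    two sides share the coordinate c only.  A label from one side then meets a
    label from the other in the empty set or in {c}, that is, in the label of a
    or of b, so the glued labelling is isometric; this gives the upper bound.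
    It also shows that both sides are isometric in G and that any two vertices
    on opposite sides have a geodesic through a or b.  Hence in any cube
    embedding of G with a at the origin the coordinates used by both sides are
    among those of b, of which there is one; this gives the lower bound. *)

Require Import Defs.
From mathcomp Require Import all_boot.
From mathcomp Require Import finmap zify.
From mathcomp Require Import boolp classical_sets functions cardinality.

Set Implicit Arguments.
Unset Strict Implicit.
Unset Printing Implicit Defensive.

Local Open Scope fset_scope.
Local Open Scope nat_scope.

(** * Symmetric differences and betweenness in the hypercube *)

Section SymmetricDifference.
Variable X : choiceType.
Implicit Types P Q R W : {fset X}.

Lemma in_symdiff P Q x : (x \in symdiff P Q) = (x \in P) (+) (x \in Q).
Proof. by rewrite !inE; case: (x \in P); case: (x \in Q). Qed.

Lemma symdiff0s P : symdiff fset0 P = P.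
Proof. by apply/fsetP => x; rewrite in_symdiff inE. Qed.

Lemma symdiffss P : symdiff P P = fset0.
Proof. by apply/fsetP => x; rewrite in_symdiff inE addbb. Qed.

Lemma symdiff_eq0 P Q : (symdiff P Q == fset0) = (P == Q).
Proof.
apply/eqP/eqP => [PQ0|->]; last exact: symdiffss.
by apply/fsetP => x; have := in_symdiff P Q x; rewrite PQ0 inE; do 2 case: (x \in _).
Qed.

Lemma symdiff_translate R P Q : symdiff (symdiff R P) (symdiff R Q) = symdiff P Q.
Proof. by apply/fsetP => x; rewrite !in_symdiff; do 3 case: (x \in _). Qed.

Lemma symdiff_chain W P Q : symdiff (symdiff P W) (symdiff W Q) = symdiff P Q.
Proof. by apply/fsetP => x; rewrite !in_symdiff; do 3 case: (x \in _). Qed.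

(** Applied to [symdiff P W] and [symdiff W Q], this gives both the triangle inequality and its
    equality case. *)
Lemma card_symdiff P Q : #|` symdiff P Q| + (#|` P `&` Q|).*2 = #|` P| + #|` Q|.
Proof.
have disj : (P `\` Q) `&` (Q `\` P) = fset0.
  by apply/fsetP => x; rewrite !inE; do 2 case: (x \in _).
have := cardfsUI (P `\` Q) (Q `\` P); rewrite disj cardfs0 /symdiff.
have := cardfsID Q P; have := cardfsID P Q; rewrite (fsetIC Q P); lia.
Qed.

Lemma card_symdiff_triangle W P Q :
  #|` symdiff P Q| <= #|` symdiff P W| + #|` symdiff W Q|.
Proof. by rewrite -(symdiff_chain W) -card_symdiff leq_addr. Qed.

(** Equality holds iff [symdiff P W] and [symdiff W Q] are disjoint. A common element is one on
    which [W] disagrees with both [P] and [Q]: it is in both but not in [W], or in [W] but in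
    neither. *)
Lemma card_symdiff_between W P Q :
  #|` symdiff P Q| = #|` symdiff P W| + #|` symdiff W Q| <->
  P `&` Q `<=` W /\ W `<=` P `|` Q.
Proof.
rewrite -(symdiff_chain W P Q) -card_symdiff.
have -> : (#|` symdiff (symdiff P W) (symdiff W Q)| =
    #|` symdiff (symdiff P W) (symdiff W Q)| +
    (#|` symdiff P W `&` symdiff W Q|).*2) <->
    symdiff P W `&` symdiff W Q = fset0.
  split=> [card_eq|->]; last by rewrite cardfs0 addn0.
  by apply/eqP; rewrite -cardfs_eq0; lia.
split=> [I0|[/fsubsetP PQW /fsubsetP WPQ]]; last first.
  apply/fsetP => x; rewrite in_fsetI !in_symdiff in_fset0.
  move: (PQW x) (WPQ x); rewrite !inE.
  by case: (x \in P); case: (x \in Q); case: (x \in W) => //= h1 h2;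
    first [by have := h1 isT | by have := h2 isT].
by split; apply/fsubsetP => x; move/fsetP/(_ x): I0;
  rewrite !in_fsetI !in_symdiff !inE; do 3 case: (x \in _).
Qed.

End SymmetricDifference.

Lemma symdiff_imfset (X Y : choiceType) (h : X -> Y) (P Q : {fset X}) :
  injective h -> symdiff (h @` P) (h @` Q) = h @` symdiff P Q.
Proof.
move=> h_inj; have hE (R : {fset X}) x : (h x \in h @` R) = (x \in R).
  by apply/imfsetP/idP => [[z zR /h_inj ->]|xR]; [|exists x].
apply/fsetP => y; rewrite in_symdiff; apply/idP/imfsetP => [|[x + ->]]; last first.
  by rewrite in_symdiff !hE.
have [[x ->]|noy] := pselect (exists x, y = h x).
  by rewrite !hE -in_symdiff => xPQ; exists x.
have yN (R : {fset X}) : y \in h @` R = false.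
  by apply/negP => /imfsetP[x _ yx]; apply: noy; exists x.
by rewrite !yN.
Qed.

(** * Walks, distances and the metric of the hypercube *)

Section Walks.
Variable G : sgraph.
Implicit Types x y z : G.

Lemma has_walk0 x : has_walk x x 0.
Proof. by exists [::]. Qed.

Lemma has_walk_adj x y : adj x y -> has_walk x y 1.
Proof. by move=> xy; exists [:: y] => //=; rewrite xy. Qed.

Lemma has_walk_cat x y z m n :
  has_walk x y m -> has_walk y z n -> has_walk x z (m + n).
Proof.
move=> [s ps [<- <-]] [t pt [<- <-]]; exists (s ++ t); first by rewrite cat_path ps.
by rewrite last_cat size_cat.
Qed.

Lemma has_walk_sym x y n : has_walk x y n -> has_walk y x n.
Proof.
move=> [s ps [<- <-]]; exists (rev (belast x s)).
  by rewrite rev_path; under eq_path do rewrite adj_sym.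
by rewrite size_rev size_belast; case: s ps => //= z s _; rewrite rev_cons last_rcons.
Qed.

Lemma distP x y n :
  dist x y = Some n <->
  has_walk x y n /\ forall m, has_walk x y m -> n <= m.
Proof.
rewrite /dist; case: pselect => [walks|nowalk]; last first.
  by split=> // -[xyn _]; case: nowalk; exists n; apply/asboolP.
case: ex_minnP => k /asboolP xyk kmin; split=> [[<-]|[xyn nmin]].
  by split=> // m xym; apply: kmin; apply/asboolP.
congr Some; apply/eqP; rewrite eqn_leq nmin // kmin //; exact/asboolP.
Qed.

Lemma dist_adj x y : adj x y -> dist x y = Some 1.
Proof.
move=> xy; apply/distP; split; first exact: has_walk_adj.
case=> // -[s _ [+ /size0nil s0]]; rewrite s0 /= => eqxy.
by rewrite eqxy adj_irr in xy.
Qed.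

End Walks.

Lemma has_walk_map (G H : sgraph) (f : G -> H) x y n :
  (forall u v, adj u v -> adj (f u) (f v)) ->
  has_walk x y n -> has_walk (f x) (f y) n.
Proof.
move=> f_hom [s ps [<- <-]]; exists (map f s); last by rewrite last_map size_map.
by elim: s x ps => //= u s IHs x /andP[xu us]; rewrite f_hom ?IHs.
Qed.

(** Each step of a walk changes one element, which bounds its length from below; toggling the
    elements of [symdiff P Q] one at a time attains the bound. *)
Lemma hypercube_dist (X : choiceType) (P Q : hypercube X) :
  dist P Q = Some #|` symdiff P Q|.
Proof.
apply/distP; split=> [|m [s ps [<- <-]]]; last first.
  elim: s P ps => [|R s IHs] P /=; first by rewrite symdiffss cardfs0.
  rewrite {1}/hypercube_adj => /andP[/eqP PR /IHs le].
  by apply: leq_trans (card_symdiff_triangle R _ _) _; rewrite PR.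
move: {2}#|` symdiff P Q| (erefl #|` symdiff P Q|) => n; elim: n P => [|n IHn] P.
  move=> /eqP card0; rewrite (eqP card0); move: card0.
  by rewrite cardfs_eq0 symdiff_eq0 => /eqP ->; exact: has_walk0.
move=> cardS; have /fset0Pn[x xPQ] : symdiff P Q != fset0 by rewrite -cardfs_eq0 cardS.
pose R : hypercube X := symdiff P [fset x].
have PR : symdiff P R = [fset x].
  by apply/fsetP => y; rewrite !in_symdiff addKb.
have RQ : symdiff R Q = symdiff P Q `\ x.
  apply/fsetP => y; rewrite in_fsetD1 !in_symdiff in_fset1.
  case: eqP => [->|] /=; last by do 2 case: (y \in _).
  by move: xPQ; rewrite in_symdiff; do 2 case: (x \in _).
have cardRQ : #|` symdiff R Q| = n.
  by have := cardfsD1 x (symdiff P Q); rewrite xPQ cardS RQ add1n => -[].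
rewrite cardS -add1n; apply: (@has_walk_cat _ _ R).
  by apply: has_walk_adj; rewrite /= /hypercube_adj PR cardfs1.
by rewrite -[X in has_walk _ _ X]cardRQ; apply: IHn.
Qed.

(** * Embeddings into cubes as labellings by finite sets *)

Section CubeEmbedding.
Variables (G : sgraph) (X : choiceType).
Implicit Types (f : G -> {fset X}) (C : {fset X}).

Definition cube_embedding f := forall x y, dist x y = Some #|` symdiff (f x) (f y)|.

Lemma isometric_embedding_cube (f : G -> hypercube X) :
  isometric_embedding f <-> cube_embedding f.
Proof.
by split=> fP x y; have := fP x y; rewrite hypercube_dist.
Qed.

Lemma cube_embedding_adj f x y :
  cube_embedding f -> adj x y -> #|` symdiff (f x) (f y)| = 1.
Proof. by move=> fP /dist_adj; rewrite fP => -[]. Qed.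

Lemma cube_embedding_walk f x y :
  cube_embedding f -> has_walk x y #|` symdiff (f x) (f y)|.
Proof. by move=> fP; have /distP[] := fP x y. Qed.

(** If edges have label distance 1, the triangle inequality already bounds every walk from below, so
    one walk of the right length per pair suffices. *)
Lemma cube_embeddingI f :
  (forall x y, adj x y -> #|` symdiff (f x) (f y)| = 1) ->
  (forall x y, has_walk x y #|` symdiff (f x) (f y)|) -> cube_embedding f.
Proof.
move=> f_adj f_walk x y; apply/distP; split=> // m [s ps [<- <-]].
elim: s x ps => [|z s IHs] x /=; first by rewrite symdiffss cardfs0.
move=> /andP[/f_adj xz /IHs le].
by apply: leq_trans (card_symdiff_triangle (f z) _ _) _; rewrite xz.
Qed.

(** The finite set [C] holds all coordinates in use, so that its size can stand for the dimension
    while the type [X] stays arbitrary. *)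
Definition spanned_embedding f C := cube_embedding f /\ forall x, f x `<=` C.

(** Translation by [f a] is an isometry of the cube, and it keeps labels inside [C] because [f a]
    lies there. *)
Lemma spanned_embedding_origin f C a :
  spanned_embedding f C -> exists2 f', spanned_embedding f' C & f' a = fset0.
Proof.
move=> [fP fC]; exists (fun x => symdiff (f a) (f x)); last exact: symdiffss.
split=> x; first by move=> y; rewrite symdiff_translate.
apply/fsubsetP => z; rewrite in_symdiff.
by case: (boolP (z \in f a)) => [za _|_ /= zx];
  [apply: (fsubsetP (fC a)) | apply: (fsubsetP (fC x))].
Qed.

Lemma cube_embedding_origin_adj f a b :
  cube_embedding f -> f a = fset0 -> adj a b -> exists c, f b = [fset c].
Proof.
move=> fP fa /(cube_embedding_adj fP); rewrite fa symdiff0s => /eqP.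
by move=> /cardfs1P.
Qed.

End CubeEmbedding.

Lemma cube_embedding_imfset (G : sgraph) (X Y : choiceType) (h : X -> Y)
    (f : G -> {fset X}) : injective h ->
  cube_embedding (fun x => h @` f x) <-> cube_embedding f.
Proof.
move=> h_inj; split=> fP x y; last by rewrite fP symdiff_imfset ?card_imfset.
by rewrite fP symdiff_imfset ?card_imfset.
Qed.

(** * Isometric dimension as a minimum over finite coordinate sets *)

Section Dimension.
Local Open Scope card_scope.
Variable G : sgraph.

Lemma card_fset_sub_type (X : choiceType) (C : {fset X}) :
  [set: fset_sub_type C] #= `I_#|` C|.
Proof.
have valT : (val @` [set: fset_sub_type C] = [set` C])%classic.
  apply/seteqP; split=> [_ [z _ <-]|z zC]; first exact: valP.
  by exists [` zC].
have CI : [set` C] #= `I_#|` C| by apply/card_eq_fsetP.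
apply: card_eq_trans CI; rewrite -valT card_eq_sym.
by apply: inj_card_eq => x y _ _; exact: val_inj.
Qed.

Lemma spanned_embedding_sub (X : choiceType) (C : {fset X}) (f : G -> {fset X}) :
  spanned_embedding f C ->
  isometrically_embeddable G (hypercube (fset_sub_type C)).
Proof.
move=> [fP fC].
pose g (x : G) : {fset (fset_sub_type C)} :=
  [fset z | z in fset_sub_type C & val z \in f x].
have gE x : [fset val z | z in g x] = f x.
  apply/fsetP => z; apply/imfsetP/idP => [[u]|zx]; first by rewrite !inE /= => ux ->.
  by exists [` fsubsetP (fC x) z zx]; rewrite ?inE.
exists g; apply/isometric_embedding_cube/(cube_embedding_imfset g (@val_inj _ _ _)).
by move=> x y; rewrite !gE.
Qed.

Lemma is_isometric_dimP n :
  is_isometric_dim G n <->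
  (exists (X : choiceType) (C : {fset X}) (f : G -> {fset X}),
     spanned_embedding f C /\ #|` C| = n) /\
  (forall (X : choiceType) (C : {fset X}) (f : G -> {fset X}),
     spanned_embedding f C -> n <= #|` C|).
Proof.
split=> [[[X [Xn [f fP]]] n_min]|[[X [C [f [fC <-]]]] n_min]].
  split=> [|Y C g gC].
    have /finite_fsetP[C XC] : finite_set [set: X] by apply/finite_setP; exists n.
    exists X, C, f; split; last by apply/card_eq_fsetP; rewrite -XC.
    split=> [|x]; first exact/isometric_embedding_cube.
    by apply/fsubsetP => z _; have : [set: X]%classic z by []; rewrite XC.
  have := n_min _ (spanned_embedding_sub gC).
  by rewrite (card_le_eqr (card_fset_sub_type C)) card_le_II.
split.
  exists (fset_sub_type C); split; first exact: card_fset_sub_type.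
  exact: spanned_embedding_sub fC.
move=> Y [g gP].
suff [D D_card] : exists D : {fset Y}, #|` C| <= #|` D|.
  have DI : [set` D] #= `I_#|` D| by apply/card_eq_fsetP.
  apply: (@card_le_trans _ _ _ [set` D]); last exact: subset_card_le.
  by rewrite (card_le_eqr DI) card_le_II.
(* An infinite [Y] contains a finite set with at least as many elements as [C]; a finite [Y] itself
   spans the embedding, so minimality applies. *)
have [/finite_fsetP[D YD]|/infinite_set_fsetP/(_ #|` C|)[D _ ?]] :=
  pselect (finite_set [set: Y]); last by exists D.
exists D; apply: (n_min _ _ g); split=> [|x]; first exact/isometric_embedding_cube.
by apply/fsubsetP => z _; have : [set: Y]%classic z by []; rewrite YD.
Qed.

Lemma isometric_dimE n : is_isometric_dim G n -> isometric_dim G = n.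
Proof.
move=> nP; apply: xget_unique => // m /is_isometric_dimP[[X [C [f [fC <-]]]] m_min].
move: nP => /is_isometric_dimP[[Y [D [g [gD <-]]]] n_min].
by apply/eqP; rewrite eqn_leq (m_min _ _ _ gD) (n_min _ _ _ fC).
Qed.

(** Finitely many vertices use finitely many coordinates: the union of their labels spans the
    embedding, so the minimum is over a nonempty set of naturals. *)
Lemma isometric_dimP :
  finite_graph G -> partial_cube G -> is_isometric_dim G (isometric_dim G).
Proof.
move=> /finite_fsetP[S GS] [X [f /isometric_embedding_cube fP]].
apply: xgetPex.
pose spans n := exists (X : choiceType) (C : {fset X}) (f : G -> {fset X}),
  spanned_embedding f C /\ #|` C| = n.
have ex_spans : exists n, `[< spans n >].
  exists #|` \bigcup_(x <- S) f x|; apply/asboolP.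
  exists X, (\bigcup_(x <- S) f x), f; split=> //; split=> // x.
  by apply: bigfcup_sup => //; have : [set: G]%classic x by []; rewrite GS.
case: (ex_minnP ex_spans) => n /asboolP nP n_min; exists n.
apply/is_isometric_dimP; split=> // Y C g gC; apply: n_min; apply/asboolP.
by exists Y, C, g.
Qed.

End Dimension.

(** * Gluing labellings along the common edge *)

Section Pasting.
Variables (G1 G2 G : sgraph) (a1 b1 : G1) (a2 b2 : G2) (q : G1 + G2 -> G).
Hypothesis q_surj : forall w, exists u, q u = w.
Hypothesis q_eq : forall u v, q u = q v <-> pasted a1 b1 a2 b2 u v.
Hypothesis q_adj : forall w z, adj w z <->
  exists u v, [/\ q u = w, q v = z & disjoint_union_adj u v].

Lemma pasting_a : q (inr a2) = q (inl a1).
Proof. by apply/q_eq; left. Qed.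

Lemma pasting_b : q (inr b2) = q (inl b1).
Proof. by apply/q_eq; right. Qed.

Lemma pasting_walkl x y n : has_walk x y n -> has_walk (q (inl x)) (q (inl y)) n.
Proof.
apply: (has_walk_map (f := q \o inl)) => u v uv.
by apply/q_adj; exists (inl u), (inl v).
Qed.

Lemma pasting_walkr x y n : has_walk x y n -> has_walk (q (inr x)) (q (inr y)) n.
Proof.
apply: (has_walk_map (f := q \o inr)) => u v uv.
by apply/q_adj; exists (inr u), (inr v).
Qed.

Lemma glue_cube_embeddings (Z : choiceType) (g1 : G1 -> {fset Z})
    (g2 : G2 -> {fset Z}) c :
  cube_embedding g1 -> cube_embedding g2 ->
  g1 a1 = fset0 -> g2 a2 = fset0 -> g1 b1 = [fset c] -> g2 b2 = [fset c] ->
  (forall x y, g1 x `&` g2 y `<=` [fset c]) ->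
  exists g : G -> {fset Z}, [/\ cube_embedding g,
    forall x, g (q (inl x)) = g1 x & forall y, g (q (inr y)) = g2 y].
Proof.
move=> g1P g2P g1a g2a g1b g2b g12.
pose g12u (u : G1 + G2) := match u with inl x => g1 x | inr y => g2 y end.
pose g w := g12u (sval (cid (q_surj w))).
(* The label does not depend on the chosen representative, since identified vertices carry equal
   labels. *)
have gq u : g (q u) = g12u u.
  rewrite /g; case: cid => v /= /q_eq.
  by case: v u => [x|y] [x'|y'] //= => [->|[[-> ->]|[-> ->]]|[[-> ->]|[-> ->]]|->];
    rewrite ?g1a ?g2a ?g1b ?g2b.
have walk12 x y : has_walk (q (inl x)) (q (inr y)) #|` symdiff (g1 x) (g2 y)|.
  (* The meet of the two labels is the label of [a] or of [b], and it lies on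
     a geodesic. *)
  pose W := g1 x `&` g2 y.
  have -> : #|` symdiff (g1 x) (g2 y)| =
      #|` symdiff (g1 x) W| + #|` symdiff W (g2 y)|.
    apply/card_symdiff_between; split=> //.
    exact: fsubset_trans (fsubsetIl _ _) (fsubsetUl _ _).
  have := g12 x y; rewrite -/W fsubset1 => /orP[] /eqP WE.
    apply: (has_walk_cat (y := q (inl b1))).
      by rewrite WE -g1b; apply: pasting_walkl; exact: cube_embedding_walk.
    by rewrite WE -g2b -pasting_b; apply: pasting_walkr; exact: cube_embedding_walk.
  apply: (has_walk_cat (y := q (inl a1))).
    by rewrite WE -g1a; apply: pasting_walkl; exact: cube_embedding_walk.
  by rewrite WE -g2a -pasting_a; apply: pasting_walkr; exact: cube_embedding_walk.
exists g; split=> [|x|y]; [|exact: gq|exact: gq].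
apply: cube_embeddingI => w z.
  move=> /q_adj[[x|y] [[x'|y'] [<- <-]]] //= /cube_embedding_adj; rewrite !gq; exact.
have [[x|y] <-] := q_surj w; have [[x'|y'] <-] := q_surj z; rewrite !gq /=.
- by apply: pasting_walkl; exact: cube_embedding_walk.
- exact: walk12.
- by rewrite /symdiff fsetUC; apply/has_walk_sym/walk12.
- by apply: pasting_walkr; exact: cube_embedding_walk.
Qed.

Hypotheses (ab1 : adj a1 b1) (ab2 : adj a2 b2).

(** The size of [D] gives the upper bound. The remaining clauses serve the lower bound: both sides
    are isometric in [G], and labels of opposite sides meet within the label of [b]. *)
Lemma pasting_spanned_embedding (X1 X2 : choiceType) (C1 : {fset X1})
    (C2 : {fset X2}) (f1 : G1 -> {fset X1}) (f2 : G2 -> {fset X2}) :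
  spanned_embedding f1 C1 -> spanned_embedding f2 C2 ->
  exists (Z : choiceType) (D : {fset Z}) (g : G -> {fset Z}),
    [/\ spanned_embedding g D, #|` D| = #|` C1| + #|` C2| - 1,
      cube_embedding (fun x => g (q (inl x))),
      cube_embedding (fun y => g (q (inr y))) &
      exists c, [/\ g (q (inl a1)) = fset0, g (q (inl b1)) = [fset c] &
        forall x y, g (q (inl x)) `&` g (q (inr y)) `<=` [fset c]]].
Proof.
move=> /(spanned_embedding_origin a1)[{}f1 [f1P f1C] f1a].
move=> /(spanned_embedding_origin a2)[{}f2 [f2P f2C] f2a].
have [c1 f1b] := cube_embedding_origin_adj f1P f1a ab1.
have [c2 f2b] := cube_embedding_origin_adj f2P f2a ab2.
have c1C : c1 \in C1 by apply: (fsubsetP (f1C b1)); rewrite f1b inE.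
have c2C : c2 \in C2 by apply: (fsubsetP (f2C b2)); rewrite f2b inE.
pose l (x : X1) : X1 + X2 := inl x.
(* Sending [c2] to the copy of [c1] makes the ranges of [l] and [r] meet in that one coordinate. *)
pose r (y : X2) : X1 + X2 := if y == c2 then inl c1 else inr y.
have l_inj : injective l by move=> x y [].
have r_inj : injective r.
  by move=> x y; rewrite /r; case: eqP => [->|_]; case: eqP => [->|_] // [].
have rc : r c2 = l c1 by rewrite /r eqxx.
have lr x y : l x = r y -> x = c1 by rewrite /r; case: eqP => [_ []|].
have meet (P : {fset X1}) (Q : {fset X2}) : (l @` P) `&` (r @` Q) `<=` [fset l c1].
  apply/fsubsetP => z; rewrite inE => /andP[/imfsetP[x _ ->] /imfsetP[y _ /lr ->]].
  by rewrite inE.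
have g1P : cube_embedding (fun x => l @` f1 x) by apply/cube_embedding_imfset.
have g2P : cube_embedding (fun y => r @` f2 y) by apply/cube_embedding_imfset.
have [g [gP g1 g2]] : exists g : G -> {fset X1 + X2}, [/\ cube_embedding g,
    forall x, g (q (inl x)) = l @` f1 x & forall y, g (q (inr y)) = r @` f2 y].
  apply: (@glue_cube_embeddings _ _ _ (l c1)) => //=.
  - by rewrite f1a imfset0.
  - by rewrite f2a imfset0.
  - by rewrite f1b imfset_fset1.
  - by rewrite f2b imfset_fset1 rc.
exists (X1 + X2)%type, ((l @` C1) `|` (r @` C2)), g; split.
- split=> // w; have [[x|y] <-] := q_surj w.
    rewrite g1; apply: fsubset_trans (fsubsetUl _ _).
    exact/subset_imfset/fsubsetP/f1C.
  rewrite g2; apply: fsubset_trans (fsubsetUr _ _).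
  exact/subset_imfset/fsubsetP/f2C.
- have meetE : (l @` C1) `&` (r @` C2) = [fset l c1].
    apply/eqP; rewrite eqEfsubset meet fsub1set inE in_imfset //=.
    by rewrite -rc in_imfset.
  have := cardfsUI (l @` C1) (r @` C2); rewrite meetE cardfs1 !card_imfset //=; lia.
- by move=> x y; rewrite g1P !g1.
- by move=> x y; rewrite g2P !g2.
- exists (l c1); split=> [||x y]; [by rewrite g1 f1a imfset0| |by rewrite g1 g2].
  by rewrite g1 f1b imfset_fset1.
Qed.

Lemma pasting_dim n1 n2 :
  is_isometric_dim G1 n1 -> is_isometric_dim G2 n2 ->
  is_isometric_dim G (n1 + n2 - 1).
Proof.
move=> /is_isometric_dimP[[X1 [C1 [f1 [f1C <-]]]] n1_min].
move=> /is_isometric_dimP[[X2 [C2 [f2 [f2C <-]]]] n2_min].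
have [Z [D [g [[gP gD] cardD g1P g2P [c [ga gb g12]]]]]] :=
  pasting_spanned_embedding f1C f2C.
apply/is_isometric_dimP; split; first by exists Z, D, g.
move=> Y E F /(spanned_embedding_origin (q (inl a1)))[{}F [FP FE] Fa].
(* Both labellings measure the distance of [G], so betweenness found with [g] transfers to the
   arbitrary embedding [F]. *)
have dist_gF w z : #|` symdiff (F w) (F z)| = #|` symdiff (g w) (g z)|.
  by have := gP w z; rewrite FP => -[].
have ab : adj (q (inl a1)) (q (inl b1)) by apply/q_adj; exists (inl a1), (inl b1).
have [d Fb] := cube_embedding_origin_adj FP Fa ab.
have F1P : cube_embedding (fun x => F (q (inl x))).
  by move=> x y; rewrite g1P dist_gF.
have F2P : cube_embedding (fun y => F (q (inr y))).
  by move=> x y; rewrite g2P dist_gF.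
(* A geodesic from one side to the other runs through [a] or [b], so that a
   coordinate used by both ends is used by [a] or [b]. *)
have F12 x y : F (q (inl x)) `&` F (q (inr y)) `<=` [fset d].
  have between w : g w = g (q (inl x)) `&` g (q (inr y)) ->
      F (q (inl x)) `&` F (q (inr y)) `<=` F w.
    move=> gw; have /card_symdiff_between[] // :
      #|` symdiff (F (q (inl x))) (F (q (inr y)))| =
      #|` symdiff (F (q (inl x))) (F w)| + #|` symdiff (F w) (F (q (inr y)))|.
    rewrite !dist_gF; apply/card_symdiff_between; rewrite gw; split=> //.
    exact: fsubset_trans (fsubsetIl _ _) (fsubsetUl _ _).
  have := g12 x y; rewrite fsubset1 => /orP[] /eqP gE.
    by rewrite -Fb; apply: between; rewrite gb.
  by apply: fsubset_trans (fsub0set _); rewrite -Fa; apply: between; rewrite ga.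
(* [E1] and [E2] are the coordinates used by each side. They span the restrictions of [F], and share
   at most [d], so inclusion and exclusion gives the bound. *)
pose E1 := [fset z in E | `[< exists x, z \in F (q (inl x)) >]].
pose E2 := [fset z in E | `[< exists y, z \in F (q (inr y)) >]].
have le1 : #|` C1| <= #|` E1|.
  apply: (n1_min _ _ (fun x => F (q (inl x)))); split=> // x; apply/fsubsetP => z zx.
  by rewrite !inE (fsubsetP (FE _) _ zx); apply/asboolP; exists x.
have le2 : #|` C2| <= #|` E2|.
  apply: (n2_min _ _ (fun y => F (q (inr y)))); split=> // y; apply/fsubsetP => z zy.
  by rewrite !inE (fsubsetP (FE _) _ zy); apply/asboolP; exists y.
have leI : #|` E1 `&` E2| <= 1.
  rewrite -(cardfs1 d); apply/fsubset_leq_card/fsubsetP => z.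
  rewrite !inE => /andP[/andP[_ /asboolP[x zx]] /andP[_ /asboolP[y zy]]].
  by have := fsubsetP (F12 x y) z; rewrite !inE zx zy => ->.
have leU : #|` E1 `|` E2| <= #|` E|.
  by apply/fsubset_leq_card/fsubsetP => z; rewrite !inE => /orP[] /andP[].
have := cardfsUI E1 E2; lia.
Qed.

End Pasting.

Theorem theorem7p5 (G1 G2 G : sgraph) :
  finite_graph G1 -> partial_cube G1 ->
  finite_graph G2 -> partial_cube G2 ->
  edge_pasting G1 G2 G ->
  isometric_dim G = (isometric_dim G1 + isometric_dim G2 - 1)%N.
Proof.
move=> fin1 cube1 fin2 cube2 [a1 [b1 [a2 [b2 [q [[_ _ ab1 ab2] [q_surj q_eq q_adj]]]]]]].
apply: isometric_dimE.
exact: (pasting_dim q_surj q_eq q_adj ab1 ab2 (isometric_dimP fin1 cube1)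
  (isometric_dimP fin2 cube2)).
Qed.
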